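(* Let $A\in\mathbb{R}^{n\times n}$ be a symmetric positive semidefinite matrix with eigenvalues $1\ge\lambda_1>\lambda_2\ge\cdots\ge\lambda_n\ge 0$ and corresponding orthonormal eigenvectors $u_1,\dots,u_n$. Let $\beta$ satisfy $\lambda_2\le 2\sqrt{\beta}<\lambda_1$, let $w_0\in\mathbb{R}^n$ be a unit vector with $u_1^Tw_0\neq 0$, and let $(w_t)_{t\ge 0}$ be generated by $w_1=\tfrac12 A w_0$ and $w_{t+1}=A w_t-\beta w_{t-1}$ for $t\ge 1$. Then for every $t\ge 0$, $$1-\frac{(u_1^Tw_t)^2}{\|w_t\|^2}\;\le\;\frac{4}{|w_0^Tu_1|^2}\cdot\left(\frac{2\sqrt\beta}{\lambda_1+\sqrt{\lambda_1^2-4\beta}}\right)^{2t}.$$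
   Context: $\|\cdot\|$ is the Euclidean norm. The quantity $1-(u_1^Tw_t)^2/\|w_t\|^2$ is $\sin^2$ of the angle between $u_1$ and $w_t$. With the stated initialization, $w_t=p_t(A)w_0$ where $p_0(x)=1$, $p_1(x)=x/2$, $p_{t+1}(x)=x\,p_t(x)-\beta p_{t-1}(x)$. *)

(* Defs.v *)
(* MathComp; the reals are an arbitrary [R : realType]. *)
From mathcomp Require Import all_boot all_order all_algebra.
From mathcomp Require Import reals.

Set Implicit Arguments.
Unset Strict Implicit.
Unset Printing Implicit Defensive.

Import Order.TTheory GRing.Theory Num.Theory.
Local Open Scope ring_scope.

Definition dotcv (R : realType) (n : nat) (u v : 'cV[R]_n) : R :=
  (u^T *m v) 0 0.

(* The norm MathComp-Analysis puts on matrices is the sup norm, hence this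
   separate definition. *)
Definition enorm (R : realType) (n : nat) (v : 'cV[R]_n) : R :=
  Num.sqrt (\sum_(i < n) v i 0 ^+ 2).

Definition psdmx (R : realType) (n : nat) (A : 'M[R]_n) : Prop :=
  A^T = A /\ forall x : 'cV[R]_n, 0 <= (x^T *m A *m x) 0 0.

(* Each [u i] is nonzero by orthonormality, and the [u i] form a basis, so
   [lambda] lists all the eigenvalues of [A] with multiplicity. *)
Definition orthonormal_eigensystem (R : realType) (n : nat) (A : 'M[R]_n)
    (lambda : 'I_n -> R) (u : 'I_n -> 'cV[R]_n) : Prop :=
  (forall i, A *m u i = lambda i *: u i) /\
  (forall i j, dotcv (u i) (u j) = (i == j)%:R).

(* Main.v *)
(* In the eigenbasis the coordinates q_t = <u_i, w_t> obey the scalar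
   recurrence q_{t+2} = x q_{t+1} - beta q_t with x = lambda_i.  The form
   q_{t+1}^2 - x q_{t+1} q_t + beta q_t^2 is multiplied by beta at each step,
   which gives q_t^2 <= q_0^2 beta^t as long as x^2 <= 4 beta.  For i = 1 the
   recurrence has real characteristic roots a >= b >= 0, and
   q_t = q_0 (a^t + b^t) / 2 is at least q_0 a^t / 2 in absolute value.
   Parseval's identity bounds sin^2 by the ratio of the two estimates. *)
Require Import Defs.
From mathcomp Require Import all_boot all_order all_algebra.
From mathcomp Require Import reals ring lra.

Set Implicit Arguments.
Unset Strict Implicit.
Unset Printing Implicit Defensive.

Import Order.TTheory GRing.Theory Num.Theory.
Local Open Scope ring_scope.

Lemma momentum_sqr_le (R : realFieldType) (x beta : R) (q : nat -> R) :
  x ^+ 2 <= 4 * beta -> q 1%N = x / 2 * q 0%N ->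
  (forall t, q t.+2 = x * q t.+1 - beta * q t) ->
  forall t, q t ^+ 2 <= q 0%N ^+ 2 * beta ^+ t.
Proof.
move=> hx q1 qS t.
(* The conserved form with its square completed; [q1] makes the first square vanish at [s = 0]. *)
have inv s : (q s.+1 - x / 2 * q s) ^+ 2 + (beta - x ^+ 2 / 4) * q s ^+ 2 =
    (beta - x ^+ 2 / 4) * (q 0%N ^+ 2 * beta ^+ s).
  elim: s => [|s IHs]; first by rewrite q1 expr0; field.
  by rewrite [beta ^+ _]exprS [_ * (beta * _)]mulrCA [RHS]mulrCA -IHs qS; field.
have [disc0|disc_neq0] := eqVneq (beta - x ^+ 2 / 4) 0.
  (* For a double root the form no longer bounds [q s], but it is now a single square equal to zero,
     which forces a geometric sequence of ratio [x / 2]. *)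
  have qSx s : q s.+1 = x / 2 * q s.
    move: (inv s); rewrite disc0 !mul0r addr0 => /eqP.
    by rewrite sqrf_eq0 subr_eq0 => /eqP.
  have -> : beta = (x / 2) ^+ 2 by rewrite -[LHS](subrK (x ^+ 2 / 4)) disc0; field.
  elim: t => [|t IHt]; first by rewrite expr0 mulr1.
  rewrite qSx exprMn [_ ^+ t.+1]exprS [leRHS]mulrCA.
  by apply: ler_wpM2l IHt; exact: sqr_ge0.
have disc_gt0 : 0 < beta - x ^+ 2 / 4 by rewrite lt0r disc_neq0 /=; lra.
by rewrite -(ler_pM2l disc_gt0) -inv lerDr sqr_ge0.
Qed.

(** The initial step gives both characteristic roots the same weight 1/2. Hence nothing is divided
    by [a - b], and the double root [a = b] is covered as well. *)
Lemma momentum_closed_form (R : realFieldType) (a b : R) (q : nat -> R) :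
  q 1%N = (a + b) / 2 * q 0%N ->
  (forall t, q t.+2 = (a + b) * q t.+1 - a * b * q t) ->
  forall t, q t = q 0%N * ((a ^+ t + b ^+ t) / 2).
Proof.
move=> q1 qS t.
suff [] : q t = q 0%N * ((a ^+ t + b ^+ t) / 2) /\
          q t.+1 = q 0%N * ((a ^+ t.+1 + b ^+ t.+1) / 2) by [].
elim: t => [|t [IHt IHtS]]; first by rewrite q1 !expr0 !expr1; split; field.
by split=> //; rewrite qS IHt IHtS !exprS; field.
Qed.

Lemma momentum_sqr_ge (R : rcfType) (x beta : R) (q : nat -> R) :
  0 <= x -> 0 <= beta -> 4 * beta <= x ^+ 2 -> q 1%N = x / 2 * q 0%N ->
  (forall t, q t.+2 = x * q t.+1 - beta * q t) ->
  forall t, q 0%N ^+ 2 * (((x + Num.sqrt (x ^+ 2 - 4 * beta)) / 2) ^+ (2 * t))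
            <= 4 * q t ^+ 2.
Proof.
move=> x0 beta0 hx q1 qS t.
set d := Num.sqrt _; pose a := (x + d) / 2; pose b := (x - d) / 2.
have d0 : 0 <= d by exact: sqrtr_ge0.
have d2 : d ^+ 2 = x ^+ 2 - 4 * beta by rewrite sqr_sqrtr // subr_ge0.
have xE : x = a + b by rewrite /a /b; field.
have betaE : beta = a * b.
  have -> : a * b = (x ^+ 2 - d ^+ 2) / 4 by rewrite /a /b; field.
  by rewrite d2; field.
have dx : d <= x by rewrite -(ler_pXn2r (n := 2)) ?nnegrE // d2; lra.
have a0 : 0 <= a by rewrite /a; lra.
have b0 : 0 <= b by rewrite /b; lra.
have -> : q t = q 0%N * ((a ^+ t + b ^+ t) / 2).
  by apply: momentum_closed_form; rewrite -xE -?betaE.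
rewrite -/a.
have -> : 4 * (q 0%N * ((a ^+ t + b ^+ t) / 2)) ^+ 2 =
    q 0%N ^+ 2 * (a ^+ t + b ^+ t) ^+ 2 by field.
rewrite mulnC exprM ler_wpM2l ?sqr_ge0 //.
by rewrite ler_pXn2r ?nnegrE ?addr_ge0 ?exprn_ge0 // lerDl exprn_ge0.
Qed.

Section DotProduct.
Variables (R : realType) (n : nat).
Implicit Types (v x y : 'cV[R]_n) (A : 'M[R]_n) (u : 'I_n -> 'cV[R]_n).

Lemma dotcvC x y : dotcv x y = dotcv y x.
Proof. by rewrite /dotcv !mxE; apply: eq_bigr => i _; rewrite !mxE mulrC. Qed.

Lemma dotcvBr v x y : dotcv v (x - y) = dotcv v x - dotcv v y.
Proof. by rewrite /dotcv mulmxBr !mxE. Qed.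

Lemma dotcvZr (c : R) v x : dotcv v (c *: x) = c * dotcv v x.
Proof. by rewrite /dotcv -scalemxAr !mxE. Qed.

Lemma dotcv_eigen A (l : R) v x :
  A^T = A -> A *m v = l *: v -> dotcv v (A *m x) = l * dotcv v x.
Proof.
move=> symA Av; rewrite /dotcv mulmxA -[in LHS]symA -trmx_mul Av.
by rewrite linearZ /= -scalemxAl mxE.
Qed.

Lemma enorm_sqr v : enorm v ^+ 2 = \sum_i v i 0 ^+ 2.
Proof. by rewrite sqr_sqrtr // sumr_ge0 // => i _; exact: sqr_ge0. Qed.

Lemma parseval u v :
  (forall i j, dotcv (u i) (u j) = (i == j)%:R) ->
  enorm v ^+ 2 = \sum_i dotcv (u i) v ^+ 2.
Proof.
move=> u_on; pose U := \matrix_(i, j) u i j 0.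
have UUT : U *m U^T = 1%:M.
  apply/matrixP=> i j; rewrite !mxE -u_on /dotcv mxE.
  by apply: eq_bigr => k _; rewrite !mxE.
have UvE i : dotcv (u i) v = (U *m v) i 0.
  by rewrite /dotcv !mxE; apply: eq_bigr => k _; rewrite !mxE.
have sqE x : \sum_i x i 0 ^+ 2 = dotcv x x.
  by rewrite /dotcv mxE; apply: eq_bigr => i _; rewrite mxE expr2.
under eq_bigr do rewrite UvE.
(* The rows of [U] are the transposed [u i]. A one-sided inverse of a square matrix is two-sided, so
   [UUT] also yields [U^T *m U = 1%:M], and [U] preserves the norm. *)
rewrite enorm_sqr !sqE /dotcv trmx_mul mulmxA -[_ *m U]mulmxA.
by rewrite (mulmx1C UUT) mulmx1.
Qed.

End DotProduct.

(* The dimension is n.+2 >= 2; the paper's indices 1, 2 are 0, 1 : 'I_n.+2. *)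
Theorem theorem1 (R : realType) (n : nat) (A : 'M[R]_n.+2)
    (lambda : 'I_n.+2 -> R) (u : 'I_n.+2 -> 'cV[R]_n.+2)
    (beta : R) (w0 : 'cV[R]_n.+2) (w : nat -> 'cV[R]_n.+2)
    (A_psd : psdmx A)
    (A_eig : orthonormal_eigensystem A lambda u)
    (lambda1_le1 : lambda 0 <= 1)
    (lambda_gap : lambda 1 < lambda 0)
    (lambda_sorted : forall i j : 'I_n.+2, (i <= j)%N -> lambda j <= lambda i)
    (lambda_ge0 : forall i, 0 <= lambda i)
    (beta_ge0 : 0 <= beta)
    (beta_lower : lambda 1 <= 2 * Num.sqrt beta)
    (beta_upper : 2 * Num.sqrt beta < lambda 0)
    (w0_unit : enorm w0 = 1)
    (w0_u1 : dotcv (u 0) w0 != 0)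
    (w_0 : w 0%N = w0)
    (w_1 : w 1%N = 2^-1 *: (A *m w0))
    (w_rec : forall t : nat, (1 <= t)%N ->
       w t.+1 = A *m w t - beta *: w t.-1) :
  forall t : nat,
    1 - dotcv (u 0) (w t) ^+ 2 / enorm (w t) ^+ 2 <=
    4 / `|dotcv w0 (u 0)| ^+ 2 *
      (2 * Num.sqrt beta /
         (lambda 0 + Num.sqrt (lambda 0 ^+ 2 - 4 * beta))) ^+ (2 * t).
Proof.
move=> t; case: A_psd => symA _; case: A_eig => Au u_on.
have q1 i : dotcv (u i) (w 1%N) = lambda i / 2 * dotcv (u i) (w 0%N).
  by rewrite w_1 w_0 dotcvZr (dotcv_eigen _ symA (Au i)) mulrCA mulrA.
have qS i s : dotcv (u i) (w s.+2) =
    lambda i * dotcv (u i) (w s.+1) - beta * dotcv (u i) (w s).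
  by rewrite w_rec // dotcvBr dotcvZr (dotcv_eigen _ symA (Au i)).
set r := Num.sqrt beta; have r0 : 0 <= r by exact: sqrtr_ge0.
have r2 : r ^+ 2 = beta by rewrite sqr_sqrtr.
have small i : i != 0 -> lambda i ^+ 2 <= 4 * beta.
  move=> i0; have -> : 4 * beta = (2 * r) ^+ 2 by rewrite -r2; ring.
  rewrite ler_pXn2r ?nnegrE ?mulr_ge0 //; apply: le_trans beta_lower.
  by apply: lambda_sorted; rewrite lt0n.
have large : 4 * beta <= lambda 0 ^+ 2.
  have -> : 4 * beta = (2 * r) ^+ 2 by rewrite -r2; ring.
  by rewrite ler_pXn2r ?nnegrE ?mulr_ge0 // ltW.
have := momentum_sqr_ge (lambda_ge0 0) beta_ge0 large (q1 0) (qS 0) t.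
set c := dotcv (u 0) (w t); set a := _ / 2 => c_ge.
have a0 : 0 < a.
  rewrite divr_gt0 // ltr_pwDl ?sqrtr_ge0 //.
  by apply: le_lt_trans beta_upper; rewrite mulr_ge0.
have rhsE : (2 * r / (lambda 0 + Num.sqrt (lambda 0 ^+ 2 - 4 * beta))) ^+ (2 * t)
    = beta ^+ t / a ^+ (2 * t).
  have -> : lambda 0 + Num.sqrt (lambda 0 ^+ 2 - 4 * beta) = 2 * a.
    by rewrite /a; field.
  by rewrite invfM mulrACA divff ?pnatr_eq0 // mul1r expr_div_n exprM r2.
have tail_le : \sum_(i | i != 0) dotcv (u i) (w t) ^+ 2 <= beta ^+ t.
  (* Parseval at time 0: the coordinates of the unit vector [w0] off [u 0] have total square at most
     1, so the tail bound does not depend on [w0]. *)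
  have w0_le1 : \sum_(i | i != 0) dotcv (u i) (w 0%N) ^+ 2 <= 1.
    rewrite -(expr1n _ 2) -w0_unit (parseval w0 u_on) w_0 [leRHS](bigD1 0) //=.
    by rewrite lerDr sqr_ge0.
  apply: (@le_trans _ _ (\sum_(i | i != 0) dotcv (u i) (w 0%N) ^+ 2 * beta ^+ t)).
    apply: ler_sum => i i0.
    exact: momentum_sqr_le (small i i0) (q1 i) (qS i) t.
  by rewrite -mulr_suml ler_piMl ?exprn_ge0.
have c0 : 0 < dotcv (u 0) (w 0%N) ^+ 2 by rewrite exprn_even_gt0 //= w_0.
(* The lower bound keeps [w t] nonzero, so the quotient in the goal is a genuine one rather than a
   division by zero. *)
have c2 : 0 < c ^+ 2.
  have : 0 < 4 * c ^+ 2 by apply: lt_le_trans c_ge; rewrite mulr_gt0 // exprn_gt0.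
  by rewrite pmulr_rgt0.
rewrite rhsE (dotcvC w0) real_normK ?num_real // -w_0.
rewrite (parseval (w t) u_on) (bigD1 0) //= -/c.
set S := \sum_(i | _) _ in tail_le *.
have S0 : 0 <= S by apply: sumr_ge0 => i _; exact: sqr_ge0.
have -> : 1 - c ^+ 2 / (c ^+ 2 + S) = S / (c ^+ 2 + S).
  by field; rewrite gt_eqF // ltr_wpDr.
rewrite mulf_div ler_pdivrMr ?ltr_wpDr // mulrAC ler_pdivlMr; last first.
  by rewrite mulr_gt0 // exprn_gt0.
(* With denominators cleared, the goal is the product of two bounds: [tail_le] for [S], and [c_ge]
   weakened from [4 * c ^+ 2] to [4 * (c ^+ 2 + S)]. *)
rewrite [4 * beta ^+ t]mulrC -[leRHS]mulrA; apply: ler_pM tail_le _ => //; first by rewrite ltW // mulr_gt0 // exprn_gt0.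
by apply: le_trans c_ge _; rewrite ler_pM2l // lerDl.
Qed.
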